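(* Let $(V,p,e)$ be a hyperbolic system of degree $n\ge 2$ and let $0\le m\le n-1$. Then every scaled Jordan frame in $(V,p,e)$ is a scaled Jordan frame in $(V,p^{(m)},e)$. Consequently, if $(V,p,e)$ has a scaled Jordan frame, then $p^{(m)}$ is minimal.
   Context: Let $V$ be a finite-dimensional real vector space and $e\in V$ nonzero. A homogeneous polynomial $p$ of degree $n\ge 1$ on $V$ is hyperbolic in the direction $e$ if $p(e)\ne 0$ and for every $x\in V$ the univariate polynomial $t\mapsto p(te-x)$ has only real zeros; then $(V,p,e)$ is called a hyperbolic system of degree $n$. The eigenvalue map $\lambda:V\to\mathbb{R}^n$ sends $x$ to the vector of roots of $t\mapsto p(te-x)$, with multiplicity, in decreasing order. The hyperbolicity cone is $\Lambda_+=\{x\in V:\lambda(x)\ge 0\}$ and its interior is $\Lambda_{++}=\{x\in V:\lambda(x)>0\}$ (entrywise inequalities). An element $c\in V$ is of rank one if $\lambda(c)$ has exactly one nonzero entry (counted with multiplicity). A scaled Jordan frame in $(V,p,e)$ is a finite family $c_1,\ldots,c_k$ (repetitions allowed) of rank-one elements of $\Lambda_+$ with $c_1+\cdots+c_k\in\Lambda_{++}$. The derivative polynomial is $p'(x)=\frac{d}{dt}p(te+x)\big|_{t=0}$, and $p^{(0)}=p$, $p^{(1)}=p'$, $p^{(m)}=(p^{(m-1)})'$ for $m\le n-1$; $(V,p^{(m)},e)$ is a hyperbolic system of degree $n-m$. For a hyperbolic system $(V,q,e)$, the polynomial $q$ is called minimal if it has the lowest degree among all polynomials on $V$ that are hyperbolic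 in the direction $e$ and have the same hyperbolicity cone (in direction $e$) as $q$. *)

(* Defs.v *)
From HB Require Import structures.
From mathcomp Require Import all_boot all_order all_algebra.
From mathcomp Require Import boolp classical_sets reals topology normedtype derive.
From mathcomp Require Import polyrcf complex.
(* Not imported: the notations of mpoly clash with those of mathcomp-analysis. *)
From mathcomp Require mpoly.

Set Implicit Arguments.
Unset Strict Implicit.
Unset Printing Implicit Defensive.

Import Order.TTheory GRing.Theory Num.Theory.
Import numFieldNormedType.Exports.

Local Open Scope classical_set_scope.
Local Open Scope ring_scope.

Section HyperbolicSystems.
Context {R : realType} {V : vectType R}.
Implicit Types (p q : V -> R) (e x c : V) (n : nat).

(* Polynomials on V are polynomial functions V -> R. The basis used to define
   them is immaterial, and since R is infinite a function comes from at most
   one formal polynomial. The condition on msupp is P \is n.-homog, unfolded. *)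
Definition homogeneous_polynomial n p : Prop :=
  exists P : mpoly.mpoly (\dim {:V}) R,
    all (fun m => mpoly.mdeg m == n) (mpoly.msupp P) /\
    forall x, p x = mpoly.meval (fun i => coord (vbasis {:V}) i x) P.

(* The univariate polynomial t |-> p (t e - x); it is unique because R is
   infinite, and exists whenever p is a polynomial function
   (the default value 0 is then not used). *)
Definition line_poly p e x : {poly R} :=
  xget 0 [set f : {poly R} | forall t : R, f.[t] = p (t *: e - x)].

Definition only_real_zeros (f : {poly R}) : Prop :=
  forall z : complex R, root (map_poly (real_complex R) f) z -> z \is Num.real.

Definition hyperbolic_system n p e : Prop :=
  [/\ (0 < n)%N,
      homogeneous_polynomial n p,
      p e != 0 &
      forall x, only_real_zeros (line_poly p e x)].

(* rootsR lists each real root once; mup gives its multiplicity. For a hyperbolic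
   system of degree n the resulting sequence has n entries. *)
Definition eigenvalues p e x : seq R :=
  let f := line_poly p e x in
  sort >=%R (flatten [seq nseq (mup a f) a | a <- rootsR f]).

Definition hyp_cone p e : set V :=
  [set x | all (fun a => 0 <= a) (eigenvalues p e x)].

Definition hyp_cone_int p e : set V :=
  [set x | all (fun a => 0 < a) (eigenvalues p e x)].

Definition rank_one p e c : Prop :=
  count (fun a => a != 0) (eigenvalues p e c) = 1%N.

Definition scaled_jordan_frame p e (k : nat) (c : 'I_k -> V) : Prop :=
  (forall i, rank_one p e (c i) /\ hyp_cone p e (c i)) /\
  hyp_cone_int p e (\sum_(i < k) c i).

Definition deriv_poly e p : V -> R :=
  fun x => derive1 (fun t : R => p (t *: e + x)) 0.

Definition deriv_polyn e (m : nat) p : V -> R := iter m (deriv_poly e) p.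

Definition minimal_poly n q e : Prop :=
  hyperbolic_system n q e /\
  forall (d : nat) (r : V -> R), hyperbolic_system d r e ->
    hyp_cone r e = hyp_cone q e -> (n <= d)%N.

End HyperbolicSystems.

(* Main.v *)
Require Import Defs.
From mathcomp Require Import all_boot all_order all_algebra.
From mathcomp Require Import reals.
From mathcomp Require boolp classical_sets topology normedtype derive.
From mathcomp Require polyrcf complex mpoly.
From mathcomp Require Import ring lra zify.

(** The frame claim concerns one derivative at a time. Passing from p to p'
differentiates every line polynomial t |-> p(te - x). By the half-plane form of
Gauss-Lucas ([gauss_lucas_half_plane]) real roots give real roots, so p' is
hyperbolic, and positive roots give positive roots, so the open cone can only
grow. If c has rank one, p(te - c) = p(e) t^(d-1) (t - a), whose derivative
d p(e) t^(d-2) (t - (d-1)a/d) again has a single nonzero root as long as d > 1.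

For minimality it is enough that a hyperbolic q of degree d with a scaled
Jordan frame is minimal ([scaled_jordan_frame_minimal]). Choose S minimal among
the subfamilies of the frame whose sum lies in the open cone, and let r be
hyperbolic with the same cone as q.

- |S| <= deg r. The sum over a proper subfamily lies in the cone but not in its
  interior, and the interior is determined by the cone, so r vanishes there,
  but not at the sum over S. If deg r < |S|, the alternating sum of the values
  of r at all the subfamily sums would be zero
  ([alternating_sum_homogeneous]), although it has exactly one nonzero term.
- d <= |S| ([leq_size_rank_one_sum]). Adding t c with c of rank one changes q
  affinely in t, so q(e + t y) = O(t^|S|) for the sum y over S, while it grows
  like t^d because y is in the open cone.

The affine dependence follows from monotonicity of q on the open cone
([hyperbolic_monotone]): q(z + tc) is bounded by q(Me + tc), which is affine in
t. Monotonicity and the convexity of the cone are Garding's theorem. They come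
from the absence of zeros of the complex extension on x + iv for x real and v
in the open cone ([tube_cone]), proved by deforming x to 0: the roots of the
polynomials involved start in the lower half-plane and cannot cross the real
axis ([roots_stay_below]). *)

Set Implicit Arguments.
Unset Strict Implicit.
Unset Printing Implicit Defensive.

Import Order.TTheory GRing.Theory Num.Theory.

Local Open Scope ring_scope.

(** * Evaluating formal polynomials in arbitrary commutative algebras *)

Module FormalPolynomials.
Import mpoly.

Section Evaluation.
Context {R : comNzRingType} {n : nat}.
Implicit Types (P : {mpoly R[n]}).

Lemma mmap_rmorphism (A B : comNzRingType) (f : {rmorphism R -> A})
    (phi : {rmorphism A -> B}) (g : R -> B) (h : 'I_n -> A) (k : 'I_n -> B) P :
  (forall c, phi (f c) = g c) -> (forall i, phi (h i) = k i) ->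
  phi (mmap f h P) = mmap g k P.
Proof.
move=> fg hk; rewrite /mmap rmorph_sum; apply: eq_bigr => m _.
rewrite rmorphM fg; congr (_ * _).
by rewrite /mmap1 rmorph_prod; apply: eq_bigr => i _; rewrite rmorphXn hk.
Qed.

Lemma mmap_eq (A : comNzRingType) (f : R -> A) (h k : 'I_n -> A) P :
  h =1 k -> mmap f h P = mmap f k P.
Proof.
by move=> hk; apply: eq_bigr => m _; congr (_ * _); apply: eq_bigr => i _; rewrite hk.
Qed.

Lemma mmap_homog (A : comNzRingType) (f : R -> A) (h : 'I_n -> A) (a : A) d P :
  P \is d.-homog -> mmap f (fun i => a * h i) P = a ^+ d * mmap f h P.
Proof.
move=> /dhomogP hom; rewrite /mmap big_distrr /= big_seq [RHS]big_seq.
apply: eq_bigr => m mP; rewrite mulrCA; congr (_ * _).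
have <- : mdeg m = d by exact: hom.
rewrite mdegE /mmap1 -prodrXr -big_split.
by apply: eq_bigr => i _; rewrite exprMn.
Qed.

(** Monomials of degree d are products of d coordinates with repetitions; this
listing of the coordinates makes an induction on their number possible. *)
Lemma dhomog_meval_prod d P : P \is d.-homog ->
  exists2 L : seq (R * seq 'I_n), forall u, u \in L -> size u.2 = d &
    forall v, P.@[v] = \sum_(u <- L) u.1 * \prod_(j <- u.2) v j.
Proof.
move=> /dhomogP hom.
pose js (m : 'X_{1..n}) := flatten [seq nseq (m j) j | j <- index_enum 'I_n].
exists [seq (P@_m, js m) | m <- msupp P] => [_ /mapP[m mP ->] /=|v].
  have <- : mdeg m = d by exact: hom.
  rewrite size_flatten /shape -map_comp sumnE big_map mdegE.
  by apply: eq_bigr => j _; rewrite /= size_nseq.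
rewrite mevalE [RHS]big_map; apply: eq_bigr => m _; congr (_ * _).
rewrite big_flatten big_map; apply: eq_bigr => j _.
by rewrite big_nseq iter_mulr_1.
Qed.

Lemma dhomog_mderiv d P i : P \is d.-homog -> mderiv i P \is d.-1.-homog.
Proof.
move=> /dhomogP hom; rewrite /mderiv big_seq; apply: rpred_sum => m mP.
have [->|mi0] := eqVneq (m i) 0%N; first by rewrite mul0r scale0r rpred0.
apply: rpredZ; rewrite dhomogX; have <- : mdeg m = d by exact: hom.
apply/eqP.
have le1 : (U_(i) <= m)%MM by rewrite lep1mP.
by rewrite -{2}(submK le1) mdegD mdeg1 addn1.
Qed.

Lemma dhomog_directional d P (c : 'I_n -> R) :
  P \is d.-homog -> \sum_i c i *: mderiv i P \is d.-1.-homog.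
Proof. by move=> hom; apply: rpred_sum => i _; apply/rpredZ/dhomog_mderiv. Qed.

(** The chain rule. Both sides are derivations of P along [mmap polyC h], so it
is enough to compare them at the variables. *)
Lemma deriv_mmap (h : 'I_n -> {poly R}) P :
  (mmap polyC h P)^`() = \sum_i (h i)^`() * mmap polyC h (mderiv i P).
Proof.
pose ok Q := (mmap polyC h Q)^`() = \sum_i (h i)^`() * mmap polyC h (mderiv i Q).
have ok1 : ok 1.
  rewrite /ok rmorph1 derivC big1 // => i _.
  by rewrite -mpolyC1 mderivC mmap0 mulr0.
have okM Q1 Q2 : ok Q1 -> ok Q2 -> ok (Q1 * Q2).
  rewrite /ok => e1 e2; rewrite rmorphM derivM e1 e2 mulr_suml mulr_sumr -big_split.
  by apply: eq_bigr => i _; rewrite mderivM rmorphD !rmorphM /= mulrDr; ring.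
have okU i : ok 'X_i.
  rewrite /ok mmapX mmap1U (bigD1 i) //= big1 => [|j ji].
    rewrite mderivX mnm1E eqxx scale1r.
    have -> : (U_(i) - U_(i) = 0)%MM by rewrite -{1}[U_(i)%MM]add0m addmK.
    by rewrite mmapX mmap11; ring.
  by rewrite mderivX mnm1E eq_sym (negPf ji) scale0r mmap0 mulr0.
have okX m : ok 'X_[m].
  rewrite mpolyXE_id; apply: (big_ind ok) => // i _.
  elim: (m i) => [|k IH]; first by rewrite expr0.
  by rewrite exprS; apply: okM.
elim/mpolyind: P => [|c m Q _ _ IH].
  rewrite mmap0 derivC big1 // => i _.
  by rewrite mderiv0 mmap0 mulr0.
rewrite mmapD mmapZ derivD derivM derivC mul0r add0r okX IH mulr_sumr -big_split.
by apply: eq_bigr => i _; rewrite mderivD mderivZ mmapD mmapZ /=; ring.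
Qed.

End Evaluation.

Lemma poly_eq_nat (F : numDomainType) (f g : {poly F}) :
  (forall k : nat, f.[k.+1%:R] = g.[k.+1%:R]) -> f = g.
Proof.
move=> fg; apply/eqP; rewrite -subr_eq0; apply: contraT => nz.
pose s := [seq (k.+1%:R : F) | k <- iota 0 (size (f - g))].
have := @max_poly_roots _ (f - g) s nz.
rewrite size_map size_iota ltnn; apply.
  by apply/allP => _ /mapP[k _ ->]; rewrite rootE !hornerE fg subrr.
rewrite map_inj_uniq ?iota_uniq // => k l /eqP.
by rewrite eqr_nat eqSS => /eqP.
Qed.

(** Such an f is the reversal of g padded to degree N. With g itself obtained
from a homogeneous polynomial, this bounds the degree along a line and finds
the top coefficient without expanding into monomials. *)
Lemma size_reverse_poly (F : numFieldType) (f g : {poly F}) N :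
  (forall t, t != 0 -> f.[t] = t ^+ N * g.[t^-1]) ->
  (size f <= N.+1)%N /\ f`_N = g`_0.
Proof.
move=> fg; pose K := size g.
(* G is the reversal of g, and f * 'X^K = G * 'X^N avoids the negative powers. *)
pose G := \sum_(j < K) g`_j *: 'X^(K - j).
have GK i : (K < i)%N -> G`_i = 0.
  move=> Ki; rewrite coef_sum big1 // => j _; rewrite coefZ coefXn.
  by rewrite gtn_eqF ?mulr0 // (leq_ltn_trans _ Ki) ?leq_subr.
have G0 : G`_K = g`_0.
  rewrite coef_sum; case E: K => [|k].
    by rewrite big_ord0 nth_default // -/K E.
  rewrite big_ord_recl /= subn0 coefZ coefXn eqxx mulr1 big1 ?addr0 // => j _.
  by rewrite coefZ coefXn /bump /= gtn_eqF ?mulr0 // ltn_subrL.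
have eq : f * 'X^K = G * 'X^N.
  apply: poly_eq_nat => k; set t : F := k.+1%:R.
  have t0 : t != 0 by rewrite pnatr_eq0.
  rewrite !hornerM !hornerXn fg // horner_coef horner_sum.
  rewrite -mulrA [RHS]mulrC; congr (_ * _).
  rewrite mulr_suml; apply: eq_bigr => j _.
  have tj : t ^+ j != 0 by rewrite expf_neq0.
  have tK : t ^+ K = t ^+ (K - j) * t ^+ j by rewrite -exprD subnK // ltnW.
  by rewrite hornerZ hornerXn exprVn tK; field.
have coef i : f`_i = (G * 'X^N)`_(i + K).
  by rewrite -eq coefMXn ltnNge leq_addl /= addnK.
split; last by rewrite coef coefMXn ltnNge leq_addr /= addnC addnK.
apply/leq_sizeP => i Ni; rewrite coef coefMXn.
case: ltnP => // _; rewrite GK //; lia.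
Qed.

Section Lines.
Context {R : comNzRingType} {n : nat} (F : numFieldType) (f : {rmorphism R -> F}).
Implicit Types (P : {mpoly R[n]}) (z w : 'I_n -> F).

Definition line_mmap z w P : {poly F} :=
  mmap (polyC \o f) (fun i => (z i)%:P + w i *: 'X) P.

Lemma horner_line_mmap z w P t :
  (line_mmap z w P).[t] = mmap f (fun i => z i + t * w i) P.
Proof.
apply: (mmap_rmorphism (phi := horner_eval t)) => [c|i].
  by rewrite /= /horner_eval hornerC.
by rewrite /= /horner_eval !hornerE mulrC.
Qed.

(** Homogeneity gives P(z + tw) = t^d P(w + z/t), so the polynomials of the two
lines are reversals of each other. *)
Lemma line_mmap_homog z w d P : P \is d.-homog ->
  (size (line_mmap z w P) <= d.+1)%N /\ (line_mmap z w P)`_d = mmap f w P.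
Proof.
move=> hom.
have [t t0|sz ->] := @size_reverse_poly F (line_mmap z w P) (line_mmap w z P) d.
  rewrite !horner_line_mmap -mmap_homog //.
  apply: mmap_eq => i; rewrite mulrDr mulrA mulfV // mul1r; ring.
split=> //; rewrite -horner_coef0 horner_line_mmap; apply: mmap_eq => i; ring.
Qed.

End Lines.
Lemma deriv_line_mmap (F : numFieldType) n (z w : 'I_n -> F) (P : {mpoly F[n]}) :
  (line_mmap idfun z w P)^`().[0] = meval z (\sum_i w i *: mderiv i P).
Proof.
rewrite /line_mmap (deriv_mmap (fun i => (z i)%:P + w i *: 'X)).
rewrite horner_sum raddf_sum; apply: eq_bigr => i _.
rewrite /= mevalZ derivD derivC derivZ derivX add0r hornerM hornerZ hornerC mulr1.
congr (_ * _); apply: (mmap_rmorphism (phi := horner_eval 0)) => [c|j].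
  by rewrite /= /horner_eval hornerC.
by rewrite /= /horner_eval !hornerE.
Qed.

End FormalPolynomials.

Import boolp classical_sets topology normedtype derive polyrcf complex.
Import FormalPolynomials.
Import numFieldNormedType.Exports.

Local Open Scope complex_scope.
Local Open Scope ring_scope.

Local Notation toC := (real_complex _).

(** * Polynomial functions and their complex extension *)



Section ComplexExtension.
Context {R : realType} {V : vectType R}.
Local Notation C := R[i].
Implicit Types (p : V -> R) (x y v : V).

(** The value [pc x y] is that of p at x + iy. In [ext_family], [h s] is the
polynomial t |-> p(x0 + s x1 + i(y0 + s y1) + tv); that its coefficients are
polynomials [g j] in s makes its roots move continuously with s. *)
Record complex_extension d p (pc : V -> V -> C) : Prop := ComplexExtension {
  ext_real : forall x, pc x 0 = (p x)%:C;
  ext_scale : forall a b x y,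
    pc (a *: x - b *: y) (a *: y + b *: x) = (a +i* b) ^+ d * pc x y;
  ext_line : forall x v, exists f : {poly R},
    [/\ (size f <= d.+1)%N, f`_d = p v, forall t, f.[t] = p (x + t *: v) &
      forall a b, (map_poly toC f).[a +i* b] = pc (x + a *: v) (b *: v)];
  ext_family : forall x0 x1 y0 y1 v,
    exists (h : R -> {poly C}) (g : nat -> {poly C}), forall s,
    [/\ (size (h s) <= d.+1)%N, (h s)`_d = (p v)%:C,
      forall j, (h s)`_j = (g j).[s%:C] &
      forall a b, (h s).[a +i* b]
        = pc (x0 + s *: x1 + a *: v) (y0 + s *: y1 + b *: v)]
}.

Lemma complex_extension_exists d p :
  homogeneous_polynomial d p -> exists pc, complex_extension d p pc.
Proof.
move=> [P [hom pE]].
pose crd x (i : 'I_(\dim {: V})) := coord (vbasis {: V}) i x.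
pose cpt x y i := crd x i +i* crd y i.
pose fC : {rmorphism R -> C} := real_complex R.
exists (fun x y => mpoly.mmap fC (cpt x y) P).
have crdD x y i : crd (x + y) i = crd x i + crd y i by rewrite /crd linearD.
have crdN x i : crd (- x) i = - crd x i by rewrite /crd linearN.
have crdZ a x i : crd (a *: x) i = a * crd x i by rewrite /crd linearZ.
have crd0 i : crd 0 i = 0 by rewrite /crd linear0.
have realE x : mpoly.mmap fC (fun i => (crd x i)%:C) P = (p x)%:C.
  rewrite pE /mpoly.meval; apply/esym.
  exact: (mmap_rmorphism (f := idfun) (phi := fC)).
split=> [x|a b x y|x v|x0 x1 y0 y1 v].
- by rewrite -realE; apply: mmap_eq => i; rewrite /cpt crd0.
- rewrite -mmap_homog //; apply: mmap_eq => i.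
  by rewrite /cpt !(crdD, crdN, crdZ); simpc; congr (_ +i* _); ring.
- pose f := line_mmap (idfun : {rmorphism R -> R}) (crd x) (crd v) P.
  have [sz cf] := line_mmap_homog idfun (crd x) (crd v) hom.
  exists f; split=> // [|t|a b].
  + by rewrite cf pE.
  + rewrite horner_line_mmap pE; apply: mmap_eq => i.
    by rewrite [RHS]crdD crdZ.
  + have -> : map_poly toC f = line_mmap fC (fun i => (crd x i)%:C)
        (fun i => (crd v i)%:C) P.
      apply: (mmap_rmorphism (phi := map_poly fC)) => [c|i].
        by rewrite /= map_polyC.
      by rewrite rmorphD /= map_polyC map_polyZ map_polyX.
    rewrite horner_line_mmap; apply: mmap_eq => i.
    by rewrite /cpt !(crdD, crdZ); simpc.
- pose z0 := cpt x0 y0; pose z1 := cpt x1 y1; pose w i := (crd v i)%:C.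
  pose H := mpoly.mmap (polyC \o (polyC \o fC))
    (fun i => ((z0 i)%:P + (z1 i) *: 'X)%:P + (w i)%:P *: 'X) P.
  pose h s := line_mmap fC (fun i => z0 i + s%:C * z1 i) w P.
  have hE s : map_poly (horner_eval s%:C) H = h s.
    apply: (mmap_rmorphism (phi := map_poly (horner_eval s%:C))) => [c|i].
      by rewrite /= map_polyC /= /horner_eval hornerC.
    rewrite rmorphD /= map_polyC /= map_polyZ map_polyX /=.
    by rewrite /horner_eval !hornerE [s%:C * _]mulrC.
  exists h, (fun j => H`_j) => s.
  have [sz cf] := line_mmap_homog fC (fun i => z0 i + s%:C * z1 i) w hom.
  split=> // [|j|a b].
  + by rewrite cf realE.
  + by rewrite -hE coef_map.
  + rewrite horner_line_mmap; apply: mmap_eq => i.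
    rewrite /z0 /z1 /w /cpt !(crdD, crdZ); simpc.
    by congr (_ +i* _); ring.
Qed.

Lemma homogeneous_polynomialZ d p a x :
  homogeneous_polynomial d p -> p (a *: x) = a ^+ d * p x.
Proof.
move=> /complex_extension_exists[pc ext].
have := ext_scale ext a 0 x 0.
rewrite !scaler0 scale0r !addr0 subr0 !(ext_real ext) complexr0.
by rewrite -rmorphXn -rmorphM => /complexI.
Qed.

Lemma deriv_poly_lineE p e x (f : {poly R}) :
  (forall t, f.[t] = p (x + t *: e)) -> deriv_poly e p x = f^`().[0].
Proof.
move=> fE; rewrite /deriv_poly.
have -> : (fun t => p (t *: e + x)) = horner f.
  by apply/funext => t; rewrite fE addrC.
by rewrite -derivE.
Qed.

Lemma homogeneous_deriv d p e :
  homogeneous_polynomial d p -> homogeneous_polynomial d.-1 (deriv_poly e p).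
Proof.
move=> [P [hom pE]].
pose crd x (i : 'I_(\dim {: V})) := coord (vbasis {: V}) i x.
exists (\sum_i crd e i *: mpoly.mderiv i P); split.
  exact: dhomog_directional.
move=> x; pose f := line_mmap (idfun : {rmorphism R -> R}) (crd x) (crd e) P.
rewrite (@deriv_poly_lineE p e x f) => [|t]; last first.
  rewrite horner_line_mmap pE; apply: mmap_eq => i.
  by rewrite /crd linearD linearZ.
by rewrite deriv_line_mmap.
Qed.

End ComplexExtension.

(** * Real-rooted polynomials *)

Section RealRooted.

(** The logarithmic derivative of the product at z is the sum of the 1/(z - a),
and the hypothesis says that w/(z - a) has positive real part for each root a.
Multiplying by the squared modulus of the product f removes the division: the
real part of w f'(z) f(z)^* is positive, which the product rule propagates. Twice
a real part is written u + u^*. *)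
Lemma gauss_lucas_half_plane (K : numClosedFieldType) (w z : K) (s : seq K) :
  (0 < size s)%N ->
  (forall a, a \in s -> 0 < w * (z - a)^* + (w * (z - a)^*)^*) ->
  (\prod_(a <- s) ('X - a%:P))^`().[z] != 0.
Proof.
move=> s0 ws.
have re f' f : (f' == 0 :> K) -> w * f' * f^* + (w * f' * f^*)^* = 0.
  by move=> /eqP ->; rewrite !(mulr0, mul0r, rmorph0, addr0).
suff: 0 < let f := \prod_(a <- s) ('X - a%:P) in
    w * f^`().[z] * f.[z]^* + (w * f^`().[z] * f.[z]^*)^*.
  by apply: contraTneq => /eqP /re /= ->; rewrite ltxx.
have {re} : all (fun a => 0 < w * (z - a)^* + (w * (z - a)^*)^*) s by apply/allP.
elim: s s0 {ws} => // a s IH _ /= /andP[wa ws].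
rewrite big_cons; set g := \prod_(b <- s) _.
have -> : (('X - a%:P) * g)^`().[z] = g.[z] + (z - a) * g^`().[z].
  by rewrite derivM derivB derivX derivC subr0 mul1r !hornerE.
rewrite hornerM hornerXsubC.
set G := g.[z]; set G' := g^`().[z].
move: (z - a) wa => b wa.
have -> : w * (G + b * G') * (b * G)^* + (w * (G + b * G') * (b * G)^*)^*
   = (w * b^* + (w * b^*)^*) * (G * G^*)
     + (b * b^*) * (w * G' * G^* + (w * G' * G^*)^*).
  rewrite !(rmorphM, rmorphD) /= !conjCK; ring.
have b0 : b != 0 by apply: contraTneq wa => ->; rewrite rmorph0 !mulr0 rmorph0 addr0 ltxx.
case: s IH ws @g @G @G' => [|c s] IH ws g G G'.
  rewrite /G /G' /g big_nil derivC !hornerC rmorph1 !(mulr0, mulr1, mul0r) rmorph0.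
  by rewrite addr0 mulr0 addr0.
apply: ltr_wpDl; first by rewrite mulr_ge0 ?mul_conjC_ge0 ?ltW.
by rewrite mulr_gt0 ?mul_conjC_gt0 // IH.
Qed.

Context {R : realType}.
Local Notation C := R[i].
Implicit Types (f : {poly R}) (s : seq R).

Lemma map_prod_XsubC s :
  map_poly toC (\prod_(a <- s) ('X - a%:P)) = \prod_(a <- map toC s) ('X - a%:P).
Proof.
rewrite rmorph_prod big_map; apply: eq_bigr => a _.
by rewrite rmorphB /= map_polyX map_polyC.
Qed.

(** All the complex roots are real, so the factorization over R[i] has real
factors. *)
Lemma only_real_zeros_split f : f != 0 -> only_real_zeros f ->
  exists s, f = lead_coef f *: \prod_(a <- s) ('X - a%:P).
Proof.
move=> f0 rf; have [r fr] := closed_field_poly_normal (map_poly toC f).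
have fC0 : lead_coef (map_poly toC f) != 0.
  by rewrite lead_coef_eq0 map_poly_eq0.
have rr : {in r, forall z, z = toC (complex.Re z)}.
  move=> z zr; rewrite RRe_real //; apply: rf.
  by rewrite fr rootZ // root_prod_XsubC.
exists (map (@complex.Re R) r); apply: (map_inj_poly (f := toC)) => //.
  exact: complexI.
rewrite linearZ /= map_prod_XsubC [LHS]fr lead_coef_map; congr (_ *: _).
rewrite -map_comp big_map [LHS]big_seq [RHS]big_seq.
by apply: eq_bigr => z /rr {1}->.
Qed.

Lemma only_real_zeros_deriv c s : c != 0 -> (0 < size s)%N ->
  only_real_zeros (c *: \prod_(a <- s) ('X - a%:P))^`().
Proof.
move=> c0 s0 z; rewrite -deriv_map linearZ /= map_prod_XsubC derivZ rootZ ?fmorph_eq0 //.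
rewrite rootE => f'z; apply: contraLR f'z => zI.
case: z zI => x y; rewrite complex_real => y0.
(* For w = i Im z the real part of w (z - a)^* is (Im z)^2 for every real a. *)
apply: (@gauss_lucas_half_plane _ (0 +i* y)); rewrite ?size_map // => a /mapP[b _ ->].
rewrite /Num.conj /=; simpc.
have : 0 < y ^+ 2 by rewrite exprn_even_gt0.
nra.
Qed.

Lemma deriv_prod_neq0 s t : (0 < size s)%N -> (forall a, a \in s -> 0 < a) ->
  t <= 0 -> (\prod_(a <- s) ('X - a%:P))^`().[t] != 0.
Proof.
move=> s0 sp t0.
rewrite -(fmorph_eq0 (real_complex R)) -horner_map -deriv_map map_prod_XsubC.
apply: (@gauss_lucas_half_plane _ (- 1)); rewrite ?size_map // => a /mapP[b bs ->].
have b0 := sp b bs.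
rewrite -rmorphB /Num.conj /=; simpc.
lra.
Qed.

Lemma mup_prod_XsubC s a : mup a (\prod_(b <- s) ('X - b%:P)) = count_mem a s.
Proof.
elim: s => [|b s IH].
  by rewrite big_nil mupNroot // rootC oner_eq0.
rewrite big_cons mupM ?polyXsubC_eq0 ?IH //=; last first.
  by rewrite monic_neq0 // monic_prod_XsubC.
by rewrite -['X - _]expr1 mup_XsubCX; case: eqVneq.
Qed.

(** The sorted list is what the eigenvalues unfold to, so any factorization of a
line polynomial exhibits the eigenvalues up to order. *)
Lemma perm_roots_mup c s : c != 0 ->
  let f := c *: \prod_(a <- s) ('X - a%:P) in
  perm_eq (sort >=%R (flatten [seq nseq (mup a f) a | a <- rootsR f])) s.
Proof.
move=> c0; set f := _ *: _; cbv zeta; rewrite perm_sort; apply/allP => a _ /=; apply/eqP.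
have p0 : \prod_(a <- s) ('X - a%:P) != 0 :> {poly R}.
  by rewrite monic_neq0 // monic_prod_XsubC.
have f0 : f != 0 by rewrite scaler_eq0 (negPf c0).
have mupE b : mup b f = count_mem b s.
  by rewrite /f -mul_polyC mupMr ?mup_prod_XsubC // rootC.
have rootE b : root f b = (b \in s) by rewrite rootZ // root_prod_XsubC.
rewrite count_flatten -map_comp.
have -> : [seq (count_mem a \o (fun b => nseq (mup b f) b)) i | i <- rootsR f]
   = [seq (if i == a then count_mem a s else 0)%N | i <- rootsR f].
  apply: eq_map => b /=; rewrite count_nseq mupE /= eq_sym.
  by case: eqVneq => [->|]; rewrite ?mul1n ?mul0n.
rewrite sumnE big_map -big_mkcond /=.
have [as_|as_] := boolP (a \in s).
  rewrite -big_filter filter_pred1_uniq ?uniq_roots ?big_seq1 //.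
  by rewrite -(roots_on_rootsR f0) rootE.
rewrite (count_memPn as_) big1_seq // => i /andP[/eqP -> ].
Qed.

End RealRooted.

(** * Eigenvalues, cones and derivatives of hyperbolic polynomials *)

Section Hyperbolic.
Context {R : realType} {V : vectType R}.
Implicit Types (p q : V -> R) (e x y v c : V).

Lemma line_polyE p e x (f : {poly R}) :
  (forall t, f.[t] = p (t *: e - x)) -> line_poly p e x = f.
Proof.
move=> fE; apply: xget_unique => //= g gE.
by apply: poly_eq_nat => k; rewrite gE fE.
Qed.

Lemma eigenvalues_perm p e x a (s : seq R) : a != 0 ->
  (forall t, p (t *: e - x) = a * \prod_(b <- s) (t - b)) ->
  perm_eq (eigenvalues p e x) s.
Proof.
move=> a0 pE; rewrite /eigenvalues.
rewrite (@line_polyE p e x (a *: \prod_(b <- s) ('X - b%:P))).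
  exact: perm_roots_mup.
move=> t; rewrite pE hornerZ horner_prod; congr (_ * _).
by apply: eq_bigr => b _; rewrite hornerXsubC.
Qed.

Section System.
Context {d : nat} {p : V -> R} {e : V} (hyp : hyperbolic_system d p e).

Let hom : homogeneous_polynomial d p. Proof. by case: hyp. Qed.
Let pe0 : p e != 0. Proof. by case: hyp. Qed.

Lemma hyperbolicN x : p (- x) = (-1) ^+ d * p x.
Proof. by rewrite -scaleN1r (homogeneous_polynomialZ _ _ hom). Qed.

Lemma hyperbolic_split x : exists2 s : seq R, size s = d &
  line_poly p e x = p e *: \prod_(a <- s) ('X - a%:P).
Proof.
have [pc ext] := complex_extension_exists hom.
have [f [sf fd fE _]] := ext_line ext (- x) e.
have lE : line_poly p e x = f.
  by apply: line_polyE => t; rewrite fE addrC.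
have f0 : f != 0 by apply: contraNneq pe0 => f0; rewrite -fd f0 coef0.
have sfd : size f = d.+1.
  apply/eqP; rewrite eqn_leq sf ltnNge; apply: contraNN pe0.
  by move=> /leq_sizeP/(_ d (leqnn d)) <-; rewrite fd.
have lf : lead_coef f = p e by rewrite lead_coefE sfd.
have [s fs] : exists s, f = lead_coef f *: \prod_(a <- s) ('X - a%:P).
  by apply: only_real_zeros_split => //; rewrite -lE; case: hyp.
exists s; last by rewrite lE {1}fs lf.
have := sfd; rewrite fs size_scale ?lead_coef_eq0 // size_prod_XsubC.
by case.
Qed.

Lemma eigenvaluesP x : size (eigenvalues p e x) = d /\
  forall t, p (t *: e - x) = p e * \prod_(a <- eigenvalues p e x) (t - a).
Proof.
have [s sd lE] := hyperbolic_split x.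
have perm : perm_eq (eigenvalues p e x) s.
  by rewrite /eigenvalues lE; apply: perm_roots_mup.
split; first by rewrite (perm_size perm).
move=> t; rewrite (perm_big _ perm) /=.
have [pc ext] := complex_extension_exists hom.
have [f [_ _ fE _]] := ext_line ext (- x) e.
have /esym : line_poly p e x = f by apply: line_polyE => u; rewrite fE addrC.
rewrite lE addrC -fE => ->; rewrite hornerZ horner_prod; congr (_ * _).
by apply: eq_bigr => a _; rewrite hornerXsubC.
Qed.

Lemma hyperbolic_lineE x t :
  p (t *: e + x) = p e * \prod_(a <- eigenvalues p e x) (t + a).
Proof.
have [sd pE] := eigenvaluesP x.
have -> : t *: e + x = - ((- t) *: e - x) by rewrite scaleNr opprB opprK addrC.
rewrite hyperbolicN pE mulrCA -sd; congr (_ * _).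
elim: (eigenvalues p e x) => [|a s IH]; first by rewrite !big_nil expr0 mulr1.
by rewrite !big_cons -IH /= exprS; ring.
Qed.

Lemma hyp_coneP x : hyp_cone p e x <-> forall s, 0 < s -> p (s *: e + x) != 0.
Proof.
split=> [/allP xp s s0|xp].
  rewrite hyperbolic_lineE mulf_neq0 // prodf_seq_neq0.
  by apply/allP => a /xp a0; rewrite gt_eqF // ltr_wpDr.
apply/allP => a ax; rewrite leNgt; apply/negP => a0.
have /xp : 0 < - a by rewrite oppr_gt0.
rewrite hyperbolic_lineE => /negP; apply; rewrite mulf_eq0 prodf_seq_eq0.
by apply/orP; right; apply/hasP; exists a; rewrite //= addNr.
Qed.

Lemma hyp_cone_intP x :
  hyp_cone_int p e x <-> forall s, 0 <= s -> p (s *: e + x) != 0.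
Proof.
split=> [/allP xp s s0|xp].
  rewrite hyperbolic_lineE mulf_neq0 // prodf_seq_neq0.
  by apply/allP => a /xp a0; rewrite gt_eqF // ltr_wpDl.
apply/allP => a ax; rewrite ltNge; apply/negP => a0.
have /xp : 0 <= - a by rewrite oppr_ge0.
rewrite hyperbolic_lineE => /negP; apply; rewrite mulf_eq0 prodf_seq_eq0.
by apply/orP; right; apply/hasP; exists a; rewrite //= addNr.
Qed.

Lemma hyp_cone_int_gt0 x : hyp_cone_int p e x -> 0 < p x / p e.
Proof.
move=> /allP xp; rewrite -[x]add0r -(scale0r e) hyperbolic_lineE mulrAC mulfV // mul1r.
by rewrite big_seq prodr_gt0 // => a /xp; rewrite add0r.
Qed.

Lemma rank_oneP c : rank_one p e c -> hyp_cone p e c ->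
  exists2 a, 0 < a & perm_eq (eigenvalues p e c) (a :: nseq d.-1 0).
Proof.
rewrite /rank_one -size_filter => s1 /allP cp.
have [sd _] := eigenvaluesP c.
case Es : [seq a <- eigenvalues p e c | a != 0] s1 => [//|a [|//]] _.
have : a \in [seq a <- eigenvalues p e c | a != 0] by rewrite Es mem_head.
rewrite mem_filter => /andP[a0 ac].
exists a; first by rewrite lt_neqAle eq_sym a0 (cp _ ac).
have /permPl p1 := perm_filterC (fun a => a != 0) (eigenvalues p e c).
have s2 := perm_size p1.
move: p1 s2; rewrite Es /= size_filter sd => p1 [s2].
rewrite perm_sym; apply: perm_trans p1; rewrite perm_cons.
have e0 : [seq x <- eigenvalues p e c | predC (fun a => a != 0) x] = nseq d.-1 0.
  have : size [seq x <- eigenvalues p e c | predC (fun a => a != 0) x] = d.-1.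
    by rewrite size_filter -s2.
  move=> <-; apply/all_pred1P; apply/allP => b; rewrite mem_filter /= negbK.
  by case/andP.
by rewrite e0.
Qed.

Lemma line_poly_deriv x t :
  deriv_poly e p (t *: e - x) = (line_poly p e x)^`().[t].
Proof.
have [s _ lE] := hyperbolic_split x.
have [_ pE] := eigenvaluesP x.
rewrite lE (@deriv_poly_lineE _ _ p e _ ((line_poly p e x) \Po ('X + t%:P))).
  by rewrite deriv_comp !hornerE horner_comp derivD derivX derivC !hornerE lE.
move=> u; rewrite horner_comp !hornerE.
have -> : t *: e - x + u *: e = (u + t) *: e - x by rewrite scalerDl addrAC [t *: e + _]addrC.
have [pc ext] := complex_extension_exists hom.
have [f [_ _ fE _]] := ext_line ext (- x) e.
have -> : line_poly p e x = f by apply: line_polyE => w; rewrite fE addrC.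
by rewrite fE addrC.
Qed.

Lemma deriv_polyE x t : deriv_poly e p (t *: e - x)
  = p e * (\prod_(a <- eigenvalues p e x) ('X - a%:P))^`().[t].
Proof.
have [s _ lE] := hyperbolic_split x.
have perm : perm_eq (eigenvalues p e x) s.
  by rewrite /eigenvalues lE; apply: perm_roots_mup.
by rewrite line_poly_deriv lE derivZ hornerZ (perm_big _ perm).
Qed.

Lemma hyperbolic_deriv : (1 < d)%N -> hyperbolic_system d.-1 (deriv_poly e p) e.
Proof.
move=> d1; split; first by rewrite -ltnS prednK // ltnW.
- exact: homogeneous_deriv.
- rewrite (@deriv_poly_lineE _ _ p e e (p e *: ('X + 1%:P) ^+ d)) => [|t].
    rewrite derivZ deriv_exp derivD derivX derivC addr0 mul1r hornerZ hornerMn.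
    rewrite horner_exp !hornerE expr1n mulf_neq0 // pnatr_eq0; lia.
  rewrite hornerZ horner_exp !hornerE mulrC -(homogeneous_polynomialZ _ _ hom).
  by rewrite scalerDl scale1r addrC.
- move=> x.
  have -> : line_poly (deriv_poly e p) e x = (line_poly p e x)^`().
    by apply: line_polyE => t; rewrite line_poly_deriv.
  have [s sd ->] := hyperbolic_split x.
  by apply: only_real_zeros_deriv; rewrite // sd ltnW.
Qed.

End System.
End Hyperbolic.

(** * Moving the roots of a polynomial *)

Section RootHomotopy.
Context {R : realType}.
Local Notation C := R[i].
Local Notation normc := (@Normc.normc R).
Implicit Types (f g : {poly C}) (z w : C).

Lemma normc_ge0 z : 0 <= normc z.
Proof. by case: z => x y /=; rewrite sqrtr_ge0. Qed.

Lemma normc_real (x : R) : normc x%:C = `|x|.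
Proof. by rewrite /= expr0n /= addr0 sqrtr_sqr. Qed.

Lemma normcX z k : normc (z ^+ k) = normc z ^+ k.
Proof.
elim: k => [|k IH]; first by rewrite !expr0 Normc.normc1.
by rewrite !exprS Normc.normcM IH.
Qed.

Lemma normc_sum (I : Type) (r : seq I) (F : I -> C) :
  normc (\sum_(i <- r) F i) <= \sum_(i <- r) normc (F i).
Proof.
elim/big_rec2: _ => [|i y z _ le]; first by rewrite Normc.normc0.
by rewrite (le_trans (le_normcD _ _)) // lerD2l.
Qed.

Lemma Im_le_normc z : complex.Im z <= normc z.
Proof.
case: z => x y /=; rewrite (le_trans (ler_norm y)) // -sqrtr_sqr.
by rewrite ler_wsqrtr // lerDr sqr_ge0.
Qed.

Lemma poly_lipschitz g (s0 : R) : exists2 K, 0 <= K &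
  forall s, `|s - s0| <= 1 -> normc (g.[s%:C] - g.[s0%:C]) <= K * `|s - s0|.
Proof.
elim/poly_ind: g => [|g c [K K0 IH]].
  by exists 0 => // s _; rewrite !horner0 subrr Normc.normc0 mul0r.
exists (K * (`|s0| + 1) + normc g.[s0%:C]).
  by rewrite addr_ge0 ?mulr_ge0 ?addr_ge0 ?normc_ge0.
move=> s s1; rewrite !hornerMXaddC.
have -> : g.[s%:C] * s%:C + c - (g.[s0%:C] * s0%:C + c)
   = (g.[s%:C] - g.[s0%:C]) * s%:C + g.[s0%:C] * (s - s0)%:C.
  by rewrite rmorphB; ring.
rewrite (le_trans (le_normcD _ _)) // !Normc.normcM !normc_real mulrDl lerD2r.
rewrite -mulrA [_ * `|s - s0|]mulrC mulrA ler_pM ?normc_ge0 ?IH //.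
by rewrite -{1}(subrK s0 s) addrC (le_trans (ler_normD _ _)) // lerD2l.
Qed.

(** If every root of f were at distance at least eps from z, then |f(z)| would be
at least |a| eps^d; but f(z) = f(z) - f'(z) is controlled by the distance
between the coefficients. *)
Lemma root_near d a f f' (r : seq C) z B (eps : R) :
  (size f <= d.+1)%N -> f = a *: \prod_(w <- r) ('X - w%:P) -> size r = d ->
  (size f' <= d.+1)%N -> root f' z -> 1 <= B -> normc z <= B -> 0 <= eps ->
  (\sum_(j < d.+1) normc (f`_j - f'`_j)) * B ^+ d < normc a * eps ^+ d ->
  exists2 w, w \in r & normc (z - w) < eps.
Proof.
move=> sf fE rd sf' /rootP f'z B1 zB e0 lt.
apply/hasP; apply: contraLR lt => /hasPn far; rewrite -leNgt.
have : normc f.[z] <= (\sum_(j < d.+1) normc (f`_j - f'`_j)) * B ^+ d.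
  have -> : f.[z] = f.[z] - f'.[z] by rewrite f'z subr0.
  rewrite (horner_coef_wide _ sf) (horner_coef_wide _ sf') -sumrB.
  rewrite (le_trans (normc_sum _ _)) // mulr_suml ler_sum // => j _.
  rewrite -mulrBl Normc.normcM ler_wpM2l ?normc_ge0 // normcX.
  apply: (@le_trans _ _ (B ^+ j)); first by rewrite lerXn2r ?nnegrE ?normc_ge0 // (le_trans ler01).
  by rewrite ler_weXn2l // -ltnS.
apply: le_trans; rewrite fE hornerZ Normc.normcM ler_wpM2l ?normc_ge0 //.
rewrite horner_prod -rd {rd fE}; elim: r far => [|w r IH] far.
  by rewrite big_nil Normc.normc1 expr0.
rewrite big_cons Normc.normcM exprS hornerXsubC ler_pM ?exprn_ge0 //.
  by rewrite leNgt far // mem_head.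
by apply: IH => v vr; rewrite far // inE vr orbT.
Qed.

(** Cauchy's bound: beyond it the leading term dominates all the others. *)
Lemma root_bound d a f z : a != 0 -> (size f <= d.+1)%N -> f`_d = a -> root f z ->
  normc z <= 1 + (\sum_(j < d.+1) normc f`_j) / normc a.
Proof.
move=> a0 sf fd /rootP; rewrite (horner_coef_wide _ sf) => fz.
have na : 0 < normc a.
  by rewrite lt_neqAle normc_ge0 andbT eq_sym; apply: contraNneq a0 => /Normc.eq0_normc ->.
set A := \sum_(j < _) _; have A0 : 0 <= A by apply: sumr_ge0 => *; rewrite normc_ge0.
have [z1|z1] := leP (normc z) 1; first by rewrite ler_wpDr // divr_ge0 // ltW.
rewrite ler_wpDl // ler_pdivlMr //.
case: d sf fd fz @A A0 => [|k] sf fd fz A A0.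
  by move: fz; rewrite big_ord1 expr0 mulr1 fd => az; rewrite az eqxx in a0.
have zk : 0 < normc z ^+ k by rewrite exprn_gt0 // (lt_trans ltr01).
rewrite -(ler_pM2r zk).
have -> : normc z * normc a * normc z ^+ k = normc (a * z ^+ k.+1).
  by rewrite Normc.normcM normcX exprS; ring.
move: fz; rewrite big_ord_recr /= fd addrC => /eqP; rewrite addr_eq0 => /eqP ->.
rewrite normcN (le_trans (normc_sum _ _)) // mulr_suml.
apply: (@le_trans _ _ (\sum_(i < k.+1) normc f`_i * normc z ^+ k)).
  apply: ler_sum => j _; rewrite Normc.normcM normcX ler_wpM2l ?normc_ge0 //.
  by rewrite ler_weXn2l ?ltW // -ltnS.
by rewrite [leRHS]big_ord_recr /= lerDl mulr_ge0 ?normc_ge0 // ltW.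
Qed.

(** The largest imaginary part m(s) of a root of [h s] depends continuously on s,
and it never vanishes because no root is real. By the intermediate value
theorem it stays negative. *)
Lemma roots_stay_below d a (h : R -> {poly C}) (g : nat -> {poly C}) :
  a != 0 ->
  (forall s, [/\ (size (h s) <= d.+1)%N, (h s)`_d = a &
     forall j, (h s)`_j = (g j).[s%:C]]) ->
  (forall s x : R, 0 <= s <= 1 -> (h s).[x%:C] != 0) ->
  (forall z, root (h 0) z -> complex.Im z < 0) ->
  forall z, root (h 1) z -> complex.Im z < 0.
Proof.
move=> a0 hE hR h0.
have na : 0 < normc a.
  by rewrite lt_neqAle normc_ge0 andbT eq_sym; apply: contraNneq a0 => /Normc.eq0_normc ->.
have split s : exists r : seq C, h s = a *: \prod_(w <- r) ('X - w%:P) /\ size r = d.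
  have [sz hd _] := hE s.
  have hs0 : h s != 0 by apply: contraNneq a0 => h0s; rewrite -hd h0s coef0.
  have sd : size (h s) = d.+1.
    apply/eqP; rewrite eqn_leq sz ltnNge; apply: contraNN a0.
    by move=> /leq_sizeP/(_ d (leqnn d)) <-; rewrite hd.
  have lc : lead_coef (h s) = a by rewrite lead_coefE sd.
  have [r hr] := closed_field_poly_normal (h s); exists r; split; first by rewrite -lc.
  by have := sd; rewrite hr lc size_scale // size_prod_XsubC => -[].
pose r s := sval (cid (split s)).
have [hr rd] : (forall s, h s = a *: \prod_(w <- r s) ('X - w%:P)) /\ (forall s, size (r s) = d).
  by split=> s; have [] := svalP (cid (split s)).
have rootE s z : root (h s) z = (z \in r s) by rewrite hr rootZ // root_prod_XsubC.
(* Truncating at -1 keeps the sign, also when there are no roots. *)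
pose m s := \big[Num.max/(-1 : R)]_(z <- r s) complex.Im z.
have m_ge s z : z \in r s -> complex.Im z <= m s by move=> zr; apply: le_bigmax_seq.
have m_ge1 s : -1 <= m s.
  by rewrite /m; elim: (r s) => [|z l IH]; rewrite ?big_nil // big_cons le_max IH orbT.
have m_lub s u : -1 <= u -> (forall z, z \in r s -> complex.Im z <= u) -> m s <= u.
  by move=> u1 ru; rewrite /m big_seq; apply: bigmax_le.
have m_attained s : m s = -1 \/ exists2 z, z \in r s & m s = complex.Im z.
  rewrite /m; elim: (r s) => [|z l [IH|[w wl IH]]]; first by left; rewrite big_nil.
    rewrite big_cons IH maxElt; case: ifP => _; first by left.
    by right; exists z; rewrite ?mem_head.
  rewrite big_cons IH maxElt; right; case: ifP => _; last by exists z; rewrite ?mem_head.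
  by exists w; rewrite ?inE ?wl ?orbT.
have cont : continuous m.
  move=> s0.
  have [K K0 KE] : exists2 K, 0 <= K & forall s, `|s - s0| <= 1 ->
      \sum_(j < d.+1) normc ((h s)`_j - (h s0)`_j) <= K * `|s - s0|.
    pose lip j := cid2 (poly_lipschitz (g j) s0).
    exists (\sum_(j < d.+1) s2val (lip j)).
      by apply: sumr_ge0 => j _; apply: (s2valP (lip j)).
    move=> s s1; rewrite mulr_suml; apply: ler_sum => j _.
    have [_ _ ->] := hE s; have [_ _ ->] := hE s0.
    exact: (s2valP' (lip j)).
  pose B := 1 + (\sum_(j < d.+1) normc (h s0)`_j + K) / normc a.
  have B1 : 1 <= B.
    rewrite lerDl divr_ge0 ?(ltW na) // addr_ge0 //.
    by apply: sumr_ge0 => *; rewrite normc_ge0.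
  have rB s z : `|s - s0| <= 1 -> z \in r s -> normc z <= B.
    move=> s1; rewrite -rootE => zr; have [sz hd _] := hE s.
    apply: le_trans (root_bound a0 sz hd zr) _.
    rewrite lerD2l ler_pM2r ?invr_gt0 //.
    apply: (@le_trans _ _ (\sum_(j < d.+1) normc (h s0)`_j
        + \sum_(j < d.+1) normc ((h s)`_j - (h s0)`_j))).
      rewrite -big_split; apply: ler_sum => j _ /=.
      by rewrite -{1}(subrK (h s0)`_j (h s)`_j) addrC le_normcD.
    by rewrite lerD2l (le_trans (KE s s1)) // ler_piMr.
  apply/cvgrPdist_lt => eps eps0.
  pose u := normc a * (eps / 2) ^+ d.
  have u0 : 0 < u by rewrite mulr_gt0 // exprn_gt0 // divr_gt0.
  pose v := (K + 1) * B ^+ d.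
  have v0 : 0 < v by rewrite mulr_gt0 ?ltr_wpDl // exprn_gt0 // (lt_le_trans ltr01).
  pose del := Num.min 1 (u / v).
  have del0 : 0 < del by rewrite lt_min ltr01 divr_gt0.
  near=> s.
  have sdel : `|s - s0| < del.
    rewrite distrC; near: s; apply/nbhs_ballP; exists del => //= t.
  have s1 : `|s - s0| <= 1 by rewrite (le_trans (ltW sdel)) // ge_min lexx.
  have small : (\sum_(j < d.+1) normc ((h s)`_j - (h s0)`_j)) * B ^+ d < u.
    apply: (@le_lt_trans _ _ (v * `|s - s0|)).
      rewrite /v mulrAC ler_wpM2r ?exprn_ge0 ?(le_trans ler01) //.
      by rewrite (le_trans (KE s s1)) // ler_wpM2r // lerDl.
    by rewrite mulrC -ltr_pdivlMr // (lt_le_trans sdel) // ge_min lexx orbT.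
  have e2 : 0 <= eps / 2 by rewrite divr_ge0 // ltW.
  have near_le t1 t2 :
      (forall z, z \in r t1 -> exists2 w, w \in r t2 & normc (z - w) < eps / 2) ->
      m t1 <= m t2 + eps / 2.
    move=> H; apply: m_lub; first by rewrite ler_wpDr.
    move=> z /H[w wr zw]; rewrite -(subrK w z) raddfD /= addrC lerD ?m_ge //.
    by rewrite (le_trans (Im_le_normc _)) // ltW.
  have l1 : m s <= m s0 + eps / 2.
    apply: near_le => z zr.
    have [sz0 _ _] := hE s0; have [sz _ _] := hE s.
    apply: (@root_near d a (h s0) (h s) (r s0) z B) => //.
    - by rewrite rootE.
    - exact: rB zr.
    - by under eq_bigr do rewrite -normcN opprB.
  have l2 : m s0 <= m s + eps / 2.
    apply: near_le => z zr.
    have [sz0 _ _] := hE s0; have [sz _ _] := hE s.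
    apply: (@root_near d a (h s) (h s0) (r s) z B) => //.
    - by rewrite rootE.
    - by apply: (rB s0) => //; rewrite subrr normr0.
  rewrite ltr_norml; lra.
have m0 : m 0 < 0.
  have [->|[z zr ->]] := m_attained 0; first by rewrite ltrN10.
  by rewrite h0 // rootE.
move=> z; rewrite rootE => /m_ge zm; rewrite (le_lt_trans zm) // ltNge; apply/negP => m1.
have [||s s01 ms] := @IVT R m 0 1 0 ler01.
- by apply: continuous_subspaceT.
- by rewrite ge_min (ltW m0) le_max m1 orbT.
have [m11|[w wr mw]] := m_attained s; first by rewrite m11 in ms; lra.
have /negP := hR s (complex.Re w) s01; apply.
rewrite -[_ == 0]/(root _ _) rootE -[_%:C]/(_ +i* 0) -ms mw.
by case: w wr {mw}.
Unshelve. all: by end_near.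
Qed.

End RootHomotopy.

(** * Convexity of the hyperbolicity cone *)

Section Garding.
Context {R : realType} {V : vectType R}.
Context {d : nat} {p : V -> R} {e : V} (hyp : hyperbolic_system d p e).
Local Notation C := R[i].
Implicit Types (x y z w v b : V) (s t : R).

Let hom : homogeneous_polynomial d p. Proof. by case: hyp. Qed.
Let pe0 : p e != 0. Proof. by case: hyp. Qed.

Lemma seq_pos_lbound (r : seq R) : (forall a, a \in r -> 0 < a) ->
  exists2 eps, 0 < eps <= 1 & forall a, a \in r -> eps <= a.
Proof.
elim: r => [|a r IH] rp; first by exists 1; rewrite ?ltr01 ?lexx.
have [b br|eps /andP[e0 e1] er] := IH; first by rewrite rp // inE br orbT.
exists (Num.min eps a) => [|b].
  by rewrite lt_min e0 rp ?mem_head // ge_min e1.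
by rewrite inE ge_min => /orP[/eqP ->|/er ->]; rewrite ?lexx ?orbT.
Qed.

Lemma seq_ubound (r : seq R) : exists2 M, 0 < M & forall a, a \in r -> a < M.
Proof.
exists (1 + \sum_(a <- r) `|a|).
  by rewrite ltr_pwDl // sumr_ge0 // => *; rewrite normr_ge0.
move=> a ar; rewrite (big_rem a) //= addrCA.
apply: le_lt_trans (ler_norm a) _; rewrite ltrDl ltr_pwDl //.
by rewrite sumr_ge0 // => *; rewrite normr_ge0.
Qed.

(** The eigenvalues of b control p along the line through e in the direction b,
by homogenizing the factorization of p(se + b). *)
Lemma hyperbolic_direction b t :
  p (e + t *: b) = p e * \prod_(a <- eigenvalues p e b) (1 + t * a).
Proof.
have [-> | t0] := eqVneq t 0.
  by rewrite scale0r addr0 big1 ?mulr1 // => a _; rewrite mul0r addr0.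
have -> : e + t *: b = t *: (t^-1 *: e + b).
  by rewrite scalerDr scalerA mulfV // scale1r.
rewrite (homogeneous_polynomialZ _ _ hom) (hyperbolic_lineE hyp) mulrCA.
have [sd _] := eigenvaluesP hyp b; rewrite -sd; congr (_ * _).
elim: (eigenvalues p e b) => [|a r IH]; first by rewrite !big_nil expr0 mulr1.
by rewrite !big_cons -IH /= exprS; field.
Qed.

Lemma hyp_cone_int_scale x t : 0 < t -> hyp_cone_int p e x -> hyp_cone_int p e (t *: x).
Proof.
move=> t0 /(hyp_cone_intP hyp) xp; apply/(hyp_cone_intP hyp) => s s0.
have -> : s *: e + t *: x = t *: ((s / t) *: e + x).
  by rewrite scalerDr scalerA mulrC divfK ?gt_eqF.
rewrite (homogeneous_polynomialZ _ _ hom).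
apply: mulf_neq0; first by rewrite expf_neq0 // gt_eqF.
by rewrite xp // divr_ge0 // ltW.
Qed.

Lemma hyp_cone_scale x t : 0 <= t -> hyp_cone p e x -> hyp_cone p e (t *: x).
Proof.
rewrite le_eqVlt => /orP[/eqP <-|t0] /(hyp_coneP hyp) xp; apply/(hyp_coneP hyp) => s s0.
  rewrite scale0r addr0 (homogeneous_polynomialZ _ _ hom).
  by rewrite mulf_neq0 // expf_neq0 // gt_eqF.
have -> : s *: e + t *: x = t *: ((s / t) *: e + x).
  by rewrite scalerDr scalerA mulrC divfK ?gt_eqF.
rewrite (homogeneous_polynomialZ _ _ hom).
apply: mulf_neq0; first by rewrite expf_neq0 // gt_eqF.
by rewrite xp // divr_gt0.
Qed.

Lemma hyp_cone_int_shift x t :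
  0 < t -> hyp_cone p e x -> hyp_cone_int p e (t *: e + x).
Proof.
move=> t0 /(hyp_coneP hyp) xp; apply/(hyp_cone_intP hyp) => s s0.
by rewrite addrA -scalerDl xp // ltr_wpDl.
Qed.

Lemma hyp_cone_int_shrink x : hyp_cone_int p e x ->
  exists2 eps, 0 < eps & hyp_cone_int p e (x - eps *: e).
Proof.
move=> /allP xp; have [a /xp //|eps /andP[e0 _] epsP] := @seq_pos_lbound (eigenvalues p e x).
exists (eps / 2); first by rewrite divr_gt0.
apply/(hyp_cone_intP hyp) => s s0.
rewrite addrCA addrC -scalerBl (hyperbolic_lineE hyp) mulf_neq0 // prodf_seq_neq0.
by apply/allP => a /epsP ea /=; rewrite gt_eqF //; lra.
Qed.

Lemma hyp_cone_int_absorb x : exists2 M, 0 < M & hyp_cone_int p e (M *: e - x).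
Proof.
have [M M0 MP] := seq_ubound (eigenvalues p e x).
exists M => //; apply/(hyp_cone_intP hyp) => s s0.
have [_ pE] := eigenvaluesP hyp x.
rewrite addrA -scalerDl pE mulf_neq0 // prodf_seq_neq0.
by apply/allP => a /MP ea /=; rewrite gt_eqF //; lra.
Qed.

Lemma hyp_cone_int_sub x : hyp_cone_int p e x -> hyp_cone p e x.
Proof. by apply: sub_all => a /ltW. Qed.

Lemma hyp_cone_int_e : hyp_cone_int p e e.
Proof.
apply/(hyp_cone_intP hyp) => s s0.
rewrite -{2}[e]scale1r -scalerDl (homogeneous_polynomialZ _ _ hom).
by rewrite mulf_neq0 // expf_neq0 // gt_eqF // ltr_wpDl.
Qed.

Section Tube.
Context {pc : V -> V -> C} (ext : complex_extension d p pc).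

(** The directions v for which p has no zero with imaginary part v; by
homogeneity these are the directions in which p is hyperbolic. *)
Definition tube v := forall x, pc x v != 0.

Lemma tube_scale v t : t != 0 -> tube v -> tube (t *: v).
Proof.
move=> t0 tv x.
have := ext_scale ext t 0 (t^-1 *: x) v.
rewrite !scale0r subr0 addr0 scalerA mulfV // scale1r => ->.
by rewrite mulf_neq0 // complexr0 expf_neq0 // fmorph_eq0.
Qed.

Lemma tube_neq0 v : tube v -> p v != 0.
Proof.
move=> /(_ 0); have := ext_scale ext 0 1 v 0.
rewrite !scaler0 scale0r subr0 scale1r add0r (ext_real ext) => ->.
by apply: contraNneq => ->; rewrite mulr0.
Qed.

Lemma tube_e : tube e.
Proof.
move=> x; have [f [_ _ fE fC]] := ext_line ext x e.
have := fC 0 1; rewrite scale0r addr0 scale1r => <-.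
have lE : line_poly p e (- x) = f.
  by apply: line_polyE => t; rewrite fE opprK addrC.
apply/negP => /eqP f0; case: hyp => _ _ _ /(_ (- x)); rewrite lE.
move=> /(_ (0 +i* 1)); rewrite complex_real oner_eq0 => /(_ _)/negP; apply => //.
exact/rootP.
Qed.

(** Fix x and deform: the roots t of p(sx + i(e + sv) + tb) are never real for s in
[0, 1], since a real t only changes the real part of the argument. At s = 0
they are -i/a for the eigenvalues a > 0 of b, below the real axis. So at s = 1
they are still there, and i times a nonnegative number is not a root. *)
Lemma tube_step v b : hyp_cone_int p e b ->
  (forall s, 0 <= s <= 1 -> tube (e + s *: v)) ->
  forall t, 0 <= t -> tube (e + v + t *: b).
Proof.
move=> bp tv t t0 x.
have [h [g hg]] := ext_family ext 0 x e v b.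
have pb0 : (p b)%:C != 0 :> C.
  by rewrite fmorph_eq0; have := (hyp_cone_intP hyp b).1 bp 0 (lexx 0); rewrite scale0r add0r.
have hE s a c : (h s).[a +i* c] = pc (0 + s *: x + a *: b) (e + s *: v + c *: b).
  by have [] := hg s.
have below : forall z : C, root (h 1) z -> complex.Im z < 0.
  apply: (@roots_stay_below _ d _ h g pb0) => [s|s a s01|z].
  - by have [] := hg s.
  - by rewrite -complexr0 hE scale0r addr0 tv.
  case: z => a c /= hz; rewrite ltNge; apply/negP => c0.
  move: hz; rewrite rootE hE !scale0r !addr0 add0r => /eqP hz.
  (* Multiplication by -i turns ie + (a + ic)b into e + (c - ia)b, a point of the
     complexified line through e in the direction b. *)
  have := ext_scale ext 0 (-1) (a *: b) (e + c *: b).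
  rewrite hz mulr0 !scale0r sub0r add0r !scaleN1r opprK -scaleNr.
  have [f [_ _ fE <-]] := ext_line ext e b.
  have -> : f = p e *: \prod_(u <- eigenvalues p e b) (1 + u *: 'X).
    apply: poly_eq_nat => k; rewrite fE hyperbolic_direction hornerZ horner_prod.
    by congr (_ * _); apply: eq_bigr => u _; rewrite !hornerE mulrC.
  move/rootP; rewrite /root.
  rewrite linearZ rmorph_prod hornerZ mulf_eq0 fmorph_eq0 (negPf pe0) /=.
  rewrite horner_prod prodf_seq_eq0 => /hasP[u ub] /=.
  rewrite rmorphD rmorph1 /= map_polyZ map_polyX !hornerE /=.
  simpc; rewrite eq_complex /= => /andP[/eqP + _].
  have u0 : 0 < u by exact: (allP bp).
  have : 0 <= u * c by rewrite mulr_ge0 // ltW.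
  lra.
have := hE 1 0 t; rewrite !scale1r scale0r add0r addr0 => <-.
by apply/negP => /below /=; rewrite ltNge t0.
Qed.

(** Each application of [tube_step] adds one more direction of the open cone; the
second one deforms along the first direction. *)
Lemma tube_cone b1 b2 t1 t2 : hyp_cone_int p e b1 -> hyp_cone_int p e b2 ->
  0 <= t1 -> 0 <= t2 -> tube (e + t1 *: b1 + t2 *: b2).
Proof.
move=> b1p b2p t10 t20; apply: tube_step => // s /andP[s0 _].
rewrite scalerA -[e in tube (e + _)]addr0; apply: tube_step => // [? _|].
  by rewrite scaler0 addr0; apply: tube_e.
by rewrite mulr_ge0.
Qed.

Lemma tube_hyp_cone_int w : hyp_cone_int p e w -> tube w.
Proof.
move=> wp; have [eps e0 wep] := hyp_cone_int_shrink wp.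
have -> : w = eps *: (e + eps^-1 *: (w - eps *: e) + 0 *: e).
  by rewrite scale0r addr0 scalerDr scalerA mulfV ?gt_eqF // scale1r addrC subrK.
apply: tube_scale; first by rewrite gt_eqF.
by apply: tube_cone => //; [exact: hyp_cone_int_e | rewrite invr_ge0 ltW].
Qed.

End Tube.

(** A direction of the tube is not a zero of p, and s e + z + w is a multiple of
one for every s >= 0; the small multiple of e taken from z covers s = 0. *)
Lemma hyp_cone_int_add z w :
  hyp_cone_int p e z -> hyp_cone_int p e w -> hyp_cone_int p e (z + w).
Proof.
have [pc ext] := complex_extension_exists hom.
move=> zp wp; have [eps e0 zep] := hyp_cone_int_shrink zp.
apply/(hyp_cone_intP hyp) => s s0.
have s1 : 0 < s + eps by rewrite ltr_wpDl.
have -> : s *: e + (z + w) = (s + eps) *: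
    (e + (s + eps)^-1 *: (z - eps *: e) + (s + eps)^-1 *: w).
  rewrite !scalerDr !scalerA mulfV ?gt_eqF // !scale1r scalerDl.
  rewrite -!addrA; congr (_ + _); rewrite !addrA; congr (_ + _).
  by rewrite addrAC subrr add0r.
apply: (tube_neq0 ext); apply: (tube_scale ext); first by rewrite gt_eqF.
by apply: (tube_cone ext) => //; rewrite invr_ge0 ltW.
Qed.

Lemma hyp_cone_add_int z w :
  hyp_cone_int p e z -> hyp_cone p e w -> hyp_cone_int p e (z + w).
Proof.
move=> zp wp; have [eps e0 zep] := hyp_cone_int_shrink zp.
have -> : z + w = (z - eps *: e) + (eps *: e + w) by rewrite addrA subrK.
by apply: hyp_cone_int_add => //; apply: hyp_cone_int_shift.
Qed.

Lemma hyp_cone_add z w : hyp_cone p e z -> hyp_cone p e w -> hyp_cone p e (z + w).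
Proof.
move=> zp wp; apply/(hyp_coneP hyp) => s s0.
rewrite addrA; have /(hyp_cone_intP hyp)/(_ 0 (lexx 0)) :=
  hyp_cone_add_int (hyp_cone_int_shift s0 zp) wp.
by rewrite scale0r add0r.
Qed.

(** As w is a direction of the tube, t |-> p(z + tw) has only real roots. None of
them is nonnegative because the cone is convex, hence p(z + tw) / p(w) is a product of
factors t - a with a < 0, increasing for t >= 0. *)
Lemma hyperbolic_monotone z w : hyp_cone_int p e z -> hyp_cone_int p e w ->
  p z / p e <= p (z + w) / p e.
Proof.
move=> zp wp; have [pc ext] := complex_extension_exists hom.
have [f [sf fd fE fC]] := ext_line ext z w.
have pw := hyp_cone_int_gt0 hyp wp.
have pw0 : p w != 0 by apply: contraTneq pw => ->; rewrite mul0r ltxx.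
have f0 : f != 0 by apply: contraNneq pw0 => f0; rewrite -fd f0 coef0.
have lf : lead_coef f = p w.
  rewrite lead_coefE -fd; congr (_`_ _); apply/eqP; rewrite -eqSS prednK ?size_poly_gt0 //.
  by rewrite eqn_leq sf ltnNge; apply: contraNN pw0 => /leq_sizeP/(_ d (leqnn d)) <-; rewrite fd.
have [[a c]|r fr] := @only_real_zeros_split _ f f0.
  rewrite complex_real rootE fC => pz; apply: contraLR pz => c0.
  by apply: tube_scale => //; apply: (tube_hyp_cone_int ext).
have rneg a : a \in r -> a < 0.
  move=> ar; rewrite ltNge; apply/negP => a0.
  have : root f a by rewrite fr rootZ ?lead_coef_eq0 // root_prod_XsubC.
  rewrite rootE fE => /eqP pz.
  have : hyp_cone_int p e (z + a *: w).
    by apply: hyp_cone_add_int => //; apply: hyp_cone_scale => //; apply: hyp_cone_int_sub.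
  by move=> /(hyp_cone_int_gt0 hyp); rewrite pz mul0r ltxx.
have pE t : p (z + t *: w) = p w * \prod_(a <- r) (t - a).
  rewrite -fE fr lf hornerZ horner_prod; congr (_ * _).
  by apply: eq_bigr => a _; rewrite hornerXsubC.
have := pE 0; have := pE 1; rewrite scale1r scale0r addr0 => -> ->.
rewrite ![p w * _ / _]mulrAC ler_wpM2l ?(ltW pw) // big_seq [leRHS]big_seq.
by apply: ler_prod => a /rneg a0; apply/andP; split; lra.
Qed.

End Garding.

(** * Sums of rank-one elements *)

Lemma size_linear_growth (R : realType) (f : {poly R}) (K : R) :
  (forall t, 0 <= t -> 0 <= f.[t] <= K * (1 + t)) -> (size f <= 2)%N.
Proof.
move=> fK; rewrite leqNgt; apply/negP => sf.
pose l := K *: (1 + 'X) : {poly R}.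
have sl : (size l < size f)%N.
  by rewrite (leq_ltn_trans _ sf) // (leq_trans (size_scale_leq _ _)) // addrC size_XaddC.
have lE t : l.[t] = K * (1 + t) by rewrite !hornerE.
have [lf|lf] := ltP 0 (lead_coef f).
  have lfl : lead_coef (f - l) = lead_coef f by rewrite lead_coefDl // size_polyN.
  have [|n nP] := @poly_pinfty_gt_lc _ (f - l); first by rewrite lfl.
  have n0 : 0 <= Num.max n 0 by rewrite le_max lexx orbT.
  have := nP _ (_ : n <= Num.max n 0); rewrite le_max lexx => /(_ isT).
  have /andP[_] := fK _ n0; rewrite lfl !hornerE; lra.
have lf0 : 0 < lead_coef (- f).
  rewrite lead_coefN oppr_gt0 lt_neqAle lf andbT lead_coef_eq0.
  by apply: contraTneq sf => ->; rewrite size_poly0.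
have [n nP] := poly_pinfty_gt_lc lf0.
have n0 : 0 <= Num.max n 0 by rewrite le_max lexx orbT.
have := nP _ (_ : n <= Num.max n 0); rewrite le_max lexx => /(_ isT).
have /andP[+ _] := fK _ n0; rewrite hornerN; lra.
Qed.

Section RankOneSums.
Context {R : realType} {V : vectType R}.
Context {d : nat} {p : V -> R} {e : V} (hyp : hyperbolic_system d p e).
Implicit Types (x y z w c : V) (s t : R).

Let hom : homogeneous_polynomial d p. Proof. by case: hyp. Qed.
Let pe0 : p e != 0. Proof. by case: hyp. Qed.
Let Q x := p x / p e.

Let Qscale t x : Q (t *: x) = t ^+ d * Q x.
Proof. by rewrite /Q (homogeneous_polynomialZ _ _ hom) mulrA. Qed.

(** Choose M with Me - z in the open cone. By monotonicity p(z + tc) / p(e) is at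
most p(Me + tc) / p(e), which is affine in t since c has a single nonzero
eigenvalue. A polynomial of linear growth is affine. *)
Lemma rank_one_affine z c :
  hyp_cone_int p e z -> rank_one p e c -> hyp_cone p e c ->
  exists a b, forall t, p (z + t *: c) / p e = a + t * b.
Proof.
move=> zp c1 cp; have [a a0 ca] := rank_oneP hyp c1 cp.
have [pc ext] := complex_extension_exists hom.
have [f [_ _ fE _]] := ext_line ext z c.
have [M M0 Mp] := hyp_cone_int_absorb hyp z.
have Qc t : Q (e + t *: c) = 1 + t * a.
  rewrite /Q (hyperbolic_direction hyp) mulrAC mulfV // mul1r (perm_big _ ca) /=.
  by rewrite big_cons big1_seq ?mulr1 // => i /andP[_ /nseqP[-> _]]; rewrite mulr0 addr0.
pose g := (p e)^-1 *: f.
have gE t : g.[t] = Q (z + t *: c) by rewrite hornerZ fE mulrC.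
have sg : (size g <= 2)%N.
  apply: (@size_linear_growth _ g (M ^+ d * (1 + a / M))) => t t0.
  have ztp : hyp_cone_int p e (z + t *: c).
    by apply: (hyp_cone_add_int hyp) => //; apply: (hyp_cone_scale hyp).
  rewrite gE (ltW (hyp_cone_int_gt0 hyp ztp)) /=.
  apply: le_trans (hyperbolic_monotone hyp ztp Mp) _.
  have -> : z + t *: c + (M *: e - z) = M *: (e + (t / M) *: c).
    by rewrite scalerDr scalerA mulrC divfK ?gt_eqF // [LHS]addrC -addrA addKr.
  rewrite -/(Q _) Qscale Qc -[leRHS]mulrA ler_pM2l ?exprn_gt0 //.
  have aM : 0 < a / M by rewrite divr_gt0.
  have -> : t / M * a = t * (a / M) by ring.
  nra.
exists g`_0, g`_1 => t; rewrite -/(Q _) -gE (horner_coef_wide _ sg).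
by rewrite !big_ord_recl big_ord0 /= expr0 expr1 mulr1 addr0 mulrC.
Qed.

(** When c is added to the sum x, the affine function u |-> p(e + tx + uc) / p(e) is known at
u = 0, and at u = 1/M it is at most p(2e + tx) / p(e), because e - c/M is in the
open cone. Both are O(t^k) by induction, hence so is the slope, and u = t costs one
more factor t. *)
Lemma rank_one_sum_growth (I : Type) (r : seq I) (c : I -> V) :
  (forall i, rank_one p e (c i) /\ hyp_cone p e (c i)) ->
  exists2 K, 0 <= K & forall t, 0 <= t ->
    p (e + t *: \sum_(i <- r) c i) / p e <= K * (1 + t) ^+ size r.
Proof.
move=> cP; elim: r => [|i r [K K0 IH]].
  by exists 1 => // t _; rewrite big_nil scaler0 addr0 mulfV // expr0 mulr1.
have [c1 cp] := cP i.
have [M M0 Mp] := hyp_cone_int_absorb hyp (c i).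
exists (K + M * (2 ^+ d * K)); first by rewrite addr_ge0 // !mulr_ge0 ?exprn_ge0 ?(ltW M0).
move=> t t0; rewrite big_cons /= -/(Q _).
set x := \sum_(j <- r) c j in IH *.
have xp : hyp_cone p e x.
  rewrite /x; elim/big_ind: _ => [|y z yp zp|j _]; last by have [] := cP j.
    by rewrite -(scale0r (c i)); apply: (hyp_cone_scale hyp).
  exact: (hyp_cone_add hyp).
have zp : hyp_cone_int p e (e + t *: x).
  apply: (hyp_cone_add_int hyp); first exact: (hyp_cone_int_e hyp).
  exact: (hyp_cone_scale hyp).
have [a [b abE]] := rank_one_affine zp c1 cp.
have -> : e + t *: (c i + x) = e + t *: x + t *: c i.
  by rewrite scalerDr addrA addrAC.
rewrite /Q abE.
have a0 : 0 <= a.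
  have := ltW (hyp_cone_int_gt0 hyp zp); have := abE 0.
  by rewrite scale0r mul0r !addr0 => ->.
have aK : a <= K * (1 + t) ^+ size r.
  by have := IH t t0; have := abE 0; rewrite scale0r mul0r !addr0 => ->.
have bK : a + M^-1 * b <= 2 ^+ d * (K * (1 + t) ^+ size r).
  rewrite -abE.
  have zcp : hyp_cone_int p e (e + t *: x + M^-1 *: c i).
    apply: (hyp_cone_add_int hyp) => //; apply: (hyp_cone_scale hyp) => //.
    by rewrite invr_ge0 ltW.
  have ep : hyp_cone_int p e (M^-1 *: (M *: e - c i)).
    by apply: (hyp_cone_int_scale hyp) => //; rewrite invr_gt0.
  apply: le_trans (hyperbolic_monotone hyp zcp ep) _.
  have n2 : 2 != 0 :> R by rewrite pnatr_eq0.
  have -> : e + t *: x + M^-1 *: c i + M^-1 *: (M *: e - c i) = 2 *: (e + (t / 2) *: x).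
    rewrite !scalerBr !scalerDr !scalerA mulVf ?gt_eqF // scale1r [2 * _]mulrC divfK //.
    by rewrite [e - _]addrC addrA addrK -[2]/(1 + 1) scalerDl scale1r addrAC.
  rewrite -/(Q _) Qscale ler_pM2l ?exprn_gt0 //.
  have t2 : 0 <= t / 2 by rewrite divr_ge0.
  apply: le_trans (IH _ t2) _; rewrite ler_wpM2l // lerXn2r ?nnegrE; lra.
have bM : b <= M * (2 ^+ d * (K * (1 + t) ^+ size r)).
  rewrite -ler_pdivrMl // (le_trans _ bK) // lerDr //.
have T0 : 0 <= (1 + t) ^+ size r by rewrite exprn_ge0 // addr_ge0.
rewrite exprS; set T := (1 + t) ^+ _ in T0 aK bM *.
have D0 : 0 <= (2 : R) ^+ d by rewrite exprn_ge0.
have h1 : t * b <= t * (M * (2 ^+ d * (K * T))) by rewrite ler_wpM2l.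
have h2 : 0 <= M * (2 ^+ d * (K * T)) by rewrite !mulr_ge0 // ltW.
have h3 : 0 <= t * (K * T) by rewrite !mulr_ge0.
lra.
Qed.

(** For y in the open cone p(e + ty) / p(e) is the product of the d factors 1 + ta
with a > 0, which grows like t^d; the sum of k rank-one elements only allows
t^k. *)
Lemma leq_size_rank_one_sum (I : Type) (r : seq I) (c : I -> V) :
  (forall i, rank_one p e (c i) /\ hyp_cone p e (c i)) ->
  hyp_cone_int p e (\sum_(i <- r) c i) -> (d <= size r)%N.
Proof.
move=> cP yp; have [K K0 KP] := rank_one_sum_growth r cP.
have [a ay|eps /andP[e0 e1] eP] := @seq_pos_lbound _ (eigenvalues p e (\sum_(i <- r) c i)).
  exact: (allP yp).
have low t : 0 <= t -> (eps * (1 + t)) ^+ d <= K * (1 + t) ^+ size r.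
  move=> t0; apply: le_trans (KP t t0).
  rewrite (hyperbolic_direction hyp) mulrAC mulfV // mul1r.
  have [<- _] := eigenvaluesP hyp (\sum_(i <- r) c i).
  elim: (eigenvalues _ _ _) eP => [|a l IH] lP; first by rewrite big_nil expr0.
  rewrite big_cons exprS ler_pM ?exprn_ge0 ?mulr_ge0 ?(ltW e0) ?addr_ge0 //.
    have ea := lP a (mem_head _ _).
    have : t * eps <= t * a by rewrite ler_wpM2l.
    lra.
  by apply: IH => b bl; rewrite lP // inE bl orbT.
rewrite leqNgt; apply/negP => rd.
have ed : 0 < eps ^+ d by rewrite exprn_gt0.
pose t := K / eps ^+ d.
have t0 : 0 <= t by rewrite divr_ge0 // ltW.
have t1 : 1 <= 1 + t by rewrite lerDl.
have T0 : 0 < (1 + t) ^+ size r by rewrite exprn_gt0 // ltr_pwDl.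
have U1 : 1 <= (1 + t) ^+ (d - (size r).+1) by rewrite exprn_ege1.
have := low t t0; apply/negP; rewrite -ltNge exprMn.
have -> : (1 + t) ^+ d = (1 + t) ^+ size r * ((1 + t) * (1 + t) ^+ (d - (size r).+1)).
  by rewrite -exprS -exprD; congr (_ ^+ _); lia.
have -> : K = eps ^+ d * t by rewrite mulrC divfK ?gt_eqF.
by rewrite -mulrA ltr_pM2l // mulrC ltr_pM2l //; nra.
Qed.

End RankOneSums.

(** * Alternating sums over the subsets of a finite set *)

Section AlternatingSums.

Lemma sum_powersetD1 (G : zmodType) (I : finType) (S : {set I}) i (F : {set I} -> G) :
  i \in S -> \sum_(T in powerset S) F T
    = \sum_(T in powerset (S :\ i)) F T + \sum_(T in powerset (S :\ i)) F (i |: T).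
Proof.
move=> iS; rewrite (bigID (fun T : {set I} => i \notin T)) /=; congr (_ + _).
  by apply: eq_bigl => T; rewrite !powersetE subsetD1.
rewrite (reindex_onto (fun T => i |: T) (fun T => T :\ i)) => [|T].
  apply: eq_bigl => T; rewrite !powersetE finset.setU11 andbT.
  rewrite finset.subUset finset.sub1set iS subsetD1 /=.
  congr (_ && _); apply/eqP/idP => [<-|iT]; first by rewrite !inE eqxx.
  by apply/setP => j; rewrite !inE; case: eqVneq => // ->; rewrite (negPf iT).
by rewrite negbK => /andP[_ iT]; rewrite finset.setD1K.
Qed.

Context {R : realType} {V : vectType R} {I : finType} (c : I -> V).

(** Induction on the number of factors. Expand the first factor, which is additive,
over x and the c i. The term of x is a shorter product. The term of c i
only involves the subsets T that contain i; removing i from them gives a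
shorter product, based at x + c i, over the subsets of S without i. *)
Lemma alternating_sum_prod (J : Type) (l : J -> V -> R) (r : seq J) (S : {set I}) x :
  (forall j, {morph l j : y z / y + z}) -> (size r < #|S|)%N ->
  \sum_(T in powerset S) (-1) ^+ #|T| * \prod_(j <- r) l j (x + \sum_(i in T) c i) = 0.
Proof.
move=> lD.
have l0 j : l j 0 = 0 by apply: (addIr (l j 0)); rewrite -lD !add0r.
elim: r S x => [|j r IH] S x rS.
  have [i iS] : exists i, i \in S by apply/set0Pn; rewrite -card_gt0.
  rewrite (sum_powersetD1 _ iS) -big_split big1 // => T; rewrite powersetE subsetD1 => /andP[_ iT].
  by rewrite !big_nil !mulr1 cardsU1 iT exprS /=; ring.
pose P (T : {set I}) := \prod_(j <- r) l j (x + \sum_(i in T) c i).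
have step T : T \in powerset S ->
    (-1) ^+ #|T| * \prod_(j <- j :: r) l j (x + \sum_(i in T) c i)
    = l j x * ((-1) ^+ #|T| * P T)
      + \sum_(i in S) (if i \in T then l j (c i) * ((-1) ^+ #|T| * P T) else 0).
  rewrite powersetE => TS; rewrite big_cons -/(P T) lD (big_morph _ (lD j) (l0 j)).
  rewrite mulrCA mulrDl; congr (_ + _).
  rewrite mulr_suml -big_mkcondr /=; apply: eq_bigl => i.
  by case iT : (i \in T); rewrite ?andbF // (fintype.subsetP TS).
rewrite (eq_bigr _ step) big_split /= -mulr_sumr IH ?(ltnW rS) // mulr0 add0r.
rewrite exchange_big big1 //= => i iS.
rewrite (sum_powersetD1 _ iS) big1 ?add0r => [|T]; last first.
  by rewrite powersetE subsetD1 => /andP[_ /negPf ->].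
have rS' : (size r < #|S :\ i|)%N by move: rS; rewrite (cardsD1 i S) iS.
transitivity (- l j (c i) * \sum_(T in powerset (S :\ i))
    (-1) ^+ #|T| * \prod_(j <- r) l j (x + c i + \sum_(i in T) c i)).
  rewrite mulr_sumr; apply: eq_bigr => T; rewrite powersetE subsetD1 => /andP[_ iT].
  rewrite finset.setU11 cardsU1 iT exprS /P.
  under eq_bigr => k _ do rewrite big_setU1 //= addrA.
  ring.
by rewrite IH // mulr0.
Qed.

Lemma alternating_sum_homogeneous d (q : V -> R) (S : {set I}) :
  homogeneous_polynomial d q -> (d < #|S|)%N ->
  \sum_(T in powerset S) (-1) ^+ #|T| * q (\sum_(i in T) c i) = 0.
Proof.
move=> [P [hom qE]] dS.
pose crd j x := coord (vbasis {: V}) j x.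
have crdD j : {morph crd j : y z / y + z} by move=> y z; rewrite /crd linearD.
have [L Ld LE] := dhomog_meval_prod hom.
under eq_bigr => T _ do rewrite qE LE mulr_sumr.
rewrite exchange_big /= big_seq big1 // => u uL.
under eq_bigr => T _ do rewrite mulrCA -[\sum_(i in T) c i]add0r.
rewrite -mulr_sumr (alternating_sum_prod (l := crd)) ?mulr0 //.
by rewrite Ld.
Qed.

End AlternatingSums.

(** * Scaled Jordan frames *)

Section Frames.
Context {R : realType} {V : vectType R}.
Implicit Types (p q : V -> R) (e x : V).

(** If a is the nonzero eigenvalue of a rank-one element for p, then (d-1)a/d is
its nonzero eigenvalue for p'. *)
Lemma scaled_jordan_frame_deriv d p e k (c : 'I_k -> V) :
  hyperbolic_system d p e -> (1 < d)%N ->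
  scaled_jordan_frame p e c -> scaled_jordan_frame (deriv_poly e p) e c.
Proof.
move=> hyp d1 [cP sumP]; have pe0 : p e != 0 by case: hyp.
split=> [i|].
  have [c1 cp] := cP i; have [a a0 ca] := rank_oneP hyp c1 cp.
  case: d d1 hyp ca => [|[|l]] // _ hyp; rewrite [_.-1]/= => ca.
  pose b := a * l.+1%:R / l.+2%:R.
  have b0 : 0 < b by rewrite divr_gt0 ?mulr_gt0 ?ltr0n.
  have perm : perm_eq (eigenvalues (deriv_poly e p) e (c i)) (b :: nseq l 0).
    apply: (@eigenvalues_perm _ _ _ _ _ (p e * l.+2%:R)) => [|t].
      by rewrite mulf_neq0 // pnatr_eq0.
    have nseqE j : \prod_(u <- nseq j 0) ('X - u%:P) = 'X^j :> {poly R}.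
      by rewrite big_nseq iter_mulr_1 subr0.
    rewrite (deriv_polyE hyp) (perm_big _ ca) big_cons nseqE derivM derivB derivX.
    rewrite derivC subr0 mul1r derivXn hornerD hornerM hornerMn !hornerXn hornerXsubC.
    rewrite big_cons big_nseq iter_mulr_1 subr0 -mulrA; congr (_ * _).
    rewrite /b /= exprS -mulr_natr; field.
    by rewrite -natrD pnatr_eq0.
  split.
    rewrite /rank_one (permP perm) /= gt_eqF //=.
    by rewrite (@eq_in_count _ _ pred0) ?count_pred0 // => u /nseqP[-> _]; rewrite eqxx.
  rewrite /hyp_cone /= (perm_all _ perm) /= ltW //=.
  by apply/allP => u /nseqP[-> _].
have hyp' := hyperbolic_deriv hyp d1.
set x := \sum_(i < k) c i in sumP *.
apply/allP => a ax; rewrite ltNge; apply/negP => a0.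
have [sd pE] := eigenvaluesP hyp x.
have [_ p'E] := eigenvaluesP hyp' x.
have := p'E a; rewrite (deriv_polyE hyp) [in RHS](big_rem a) //= subrr mul0r mulr0.
move/eqP; rewrite mulf_eq0 (negPf pe0) /=; apply/negP.
by apply: deriv_prod_neq0 => //; [rewrite sd ltnW | exact: (allP sumP)].
Qed.

Lemma deriv_polyn_frame d p e m : hyperbolic_system d p e -> (m <= d.-1)%N ->
  hyperbolic_system (d - m) (deriv_polyn e m p) e /\
  forall k (c : 'I_k -> V), scaled_jordan_frame p e c ->
    scaled_jordan_frame (deriv_polyn e m p) e c.
Proof.
move=> hyp; elim: m => [|m IH] md; first by rewrite subn0.
have [hypm frm] := IH (ltnW md).
have dm : (1 < d - m)%N by lia.
rewrite /deriv_polyn iterS; split=> [|k c fr].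
  by rewrite subnS; apply: hyperbolic_deriv.
exact: scaled_jordan_frame_deriv hypm dm (frm _ _ fr).
Qed.

(** The right-hand side mentions only the cone, so hyperbolic polynomials with the
same cone have the same open cone. *)
Lemma hyp_cone_int_shiftP d p e x : hyperbolic_system d p e ->
  hyp_cone_int p e x <-> exists2 eps, 0 < eps & hyp_cone p e (x - eps *: e).
Proof.
move=> hyp; split=> [/(hyp_cone_int_shrink hyp)[eps e0 xe]|[eps e0 xe]].
  by exists eps => //; apply: hyp_cone_int_sub.
by have := hyp_cone_int_shift hyp e0 xe; rewrite addrC subrK.
Qed.

Lemma hyp_cone_boundary d p e x : hyperbolic_system d p e ->
  hyp_cone p e x -> ~ hyp_cone_int p e x -> p x = 0.
Proof.
move=> hyp xp nxp; apply/eqP; apply: contra_notT nxp => px.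
apply/(hyp_cone_intP hyp) => s; rewrite le_eqVlt => /orP[/eqP <-|s0].
  by rewrite scale0r add0r.
exact: (hyp_coneP hyp x).1.
Qed.

(** A minimal subfamily S with sum in the open cone has at least d members, and
at most as many as the degree of any r with the same cone. *)
Lemma scaled_jordan_frame_minimal d q e k (c : 'I_k -> V) :
  hyperbolic_system d q e -> scaled_jordan_frame q e c -> minimal_poly d q e.
Proof.
move=> hq [cP sumP]; split=> // d' r hr cone_eq.
have int_eq x : hyp_cone_int r e x <-> hyp_cone_int q e x.
  by rewrite (hyp_cone_int_shiftP x hr) (hyp_cone_int_shiftP x hq) cone_eq.
pose y (T : {set 'I_k}) := \sum_(i in T) c i.
pose P T := all (fun a => 0 < a) (eigenvalues q e (y T)).
have [S /finset.minsetP[SP Smin]] : {S | minset P S}.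
  apply: finset.ex_minset; exists [set: 'I_k]; rewrite /P /y.
  by rewrite (eq_bigl predT) => [|i]; rewrite ?inE.
have dS : (d <= #|S|)%N.
  rewrite cardE; apply: (leq_size_rank_one_sum hq (c := c)) => //.
  by rewrite big_enum.
apply: leq_trans dS _; rewrite leqNgt; apply/negP => d'S.
have [_ hom _ _] := hr.
(* Only the term of S itself survives in the alternating sum. *)
have := alternating_sum_homogeneous c hom d'S.
rewrite (bigD1 S) ?powersetE //= [X in _ + X]big1 => [|T].
  rewrite addr0 => /eqP; rewrite mulf_eq0 expf_eq0 oppr_eq0 oner_eq0 andbF /=.
  have /(hyp_cone_intP hr)/(_ 0 (lexx 0)) : hyp_cone_int r e (y S) by apply/int_eq.
  by rewrite scale0r add0r => /negP h /h.
rewrite powersetE => /andP[TS nTS]; rewrite (hyp_cone_boundary hr) ?mulr0 //.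
  rewrite cone_eq; elim/big_ind: _ => [|u v up vp|i _]; last by have [] := cP i.
    rewrite -(scale0r e); apply: (hyp_cone_scale hq) => //.
    exact/hyp_cone_int_sub/(hyp_cone_int_e hq).
  exact: (hyp_cone_add hq).
move=> /int_eq TP; move: nTS; apply/negP; rewrite negbK.
by apply/eqP/Smin.
Qed.

End Frames.

Local Close Scope ring_scope.
Local Close Scope complex_scope.

Theorem theorem4p4 (R : realType) (V : vectType R) (p : V -> R) (e : V)
    (n m : nat) (he : e <> 0%R) (hn : 2 <= n) (hm : m <= n - 1)
    (hp : hyperbolic_system n p e) :
  (forall (k : nat) (c : 'I_k -> V),
     scaled_jordan_frame p e c ->
     scaled_jordan_frame (deriv_polyn e m p) e c) /\
  ((exists (k : nat) (c : 'I_k -> V), scaled_jordan_frame p e c) ->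
   minimal_poly (n - m) (deriv_polyn e m p) e).
Proof.
rewrite subn1 in hm; have [hypm frames] := deriv_polyn_frame hp hm.
by split=> // -[k [c /frames fr]]; apply: scaled_jordan_frame_minimal hypm fr.
Qed.
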